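(* Let $G=(V,E)$ be a finite connected block graph with boundary $\delta\Omega\subseteq V$. Let $D$ be the maximum degree of $G$ and let $B$ be the maximum size of the blocks of $G$. Suppose $D\ge 2$, $|\delta\Omega|\ge 2$, and $\delta\Omega$ is a subset of the leaf set of $G$. Then the first (non-trivial) Steklov eigenvalue $\lambda_2=\lambda_2(G,\delta\Omega)$ satisfies $$\lambda_2\le\frac{4(B-1)(D-1)}{|\delta\Omega|}.$$
   Context: All graphs are finite, simple and undirected. The leaf set is the set of vertices of degree one. A block of a graph is a maximal connected subgraph that has no cut vertex of its own (so a single edge $K_2$ may be a block); the size of a block is its number of vertices. A block graph is a connected graph all of whose blocks are complete graphs. The boundary $\delta\Omega$ of a graph $G=(V,E)$ is a chosen non-empty subset of $V$. For $f\in\mathbb{R}^V$ put $$R(f)=\frac{\sum_{(x,y)\in E}(f(x)-f(y))^2}{\sum_{x\in\delta\Omega}f(x)^2},$$ where each undirected edge is counted once, with the convention $R(f)=+\infty$ if $f$ vanishes identically on $\delta\Omega$. The Steklov eigenvalues $0=\lambda_1\le\lambda_2\le\cdots\le\lambda_{|\delta\Omega|}$ of $(G,\delta\Omega)$ are $$\lambda_k(G,\delta\Omega)=\min_{W\subset\mathbb{R}^V,\ \dim W=k}\ \max_{0\ne f\in W}R(f),\qquad 1\le k\le|\delta\Omega|,$$ with $W$ ranging over linear subspaces. *)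

(* Defs.v *)
From HB Require Import structures.
From mathcomp Require Import all_boot all_order all_algebra.

Set Implicit Arguments.
Unset Strict Implicit.
Unset Printing Implicit Defensive.

Import Order.TTheory GRing.Theory Num.Theory.

(* A graph with vertices in V is a pair (vertex set, edge set), an edge being   *)
(* the 2-element set of its endpoints. This is used for the subgraphs of a      *)
(* simple graph on V, itself given by a symmetric irreflexive e : rel V.        *)
Notation graph_in V := ({set V} * {set {set V}})%type.

Section Graphs.
Context {V : finType}.

Definition adj (H : graph_in V) : rel V := [rel x y | [set x; y] \in H.2].

Definition connected_graph (H : graph_in V) : bool :=
  (H.1 != set0) && [forall x in H.1, forall y in H.1, connect (adj H) x y].

Definition complete_graph (H : graph_in V) : bool :=
  [forall x in H.1, forall y in H.1, (x != y) ==> adj H x y].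

Definition delete_vertex (H : graph_in V) (v : V) : graph_in V :=
  (H.1 :\ v, [set E in H.2 | v \notin E]).

(* Deleting v increases the number of connected components of H if and only if  *)
(* it separates two remaining vertices that are connected in H.                 *)
Definition cut_vertex (H : graph_in V) (v : V) : bool :=
  (v \in H.1) &&
  [exists x in H.1 :\ v, exists y in H.1 :\ v,
     connect (adj H) x y && ~~ connect (adj (delete_vertex H v)) x y].

Definition graph_of (e : rel V) : graph_in V :=
  ([set: V], [set [set p.1; p.2] | p : V * V & e p.1 p.2]).

Definition subgraph (H K : graph_in V) : bool :=
  [&& H.1 \subset K.1, H.2 \subset K.2 & [forall E in H.2, E \subset H.1]].

(* Subgraphs are not required to be induced, and maximality is with respect to  *)
(* inclusion of both vertices and edges.                                        *)
Definition is_block (e : rel V) (H : graph_in V) : bool :=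
  let nonseparable K :=
    [&& subgraph K (graph_of e), connected_graph K
      & [forall v, ~~ cut_vertex K v]] in
  nonseparable H && [forall K, nonseparable K && subgraph H K ==> (K == H)].

Definition block_graph (e : rel V) : bool :=
  connected_graph (graph_of e) &&
  [forall H, is_block e H ==> complete_graph H].

Definition max_block_size (e : rel V) : nat :=
  \max_(H : graph_in V | is_block e H) #|H.1|.

Definition degree (e : rel V) (x : V) : nat := #|[set y | e x y]|.

Definition max_degree (e : rel V) : nat := \max_(x : V) degree e x.

Definition leaf_set (e : rel V) : {set V} := [set x | degree e x == 1].

End Graphs.

(* Required only here, so that above set0, [set _ | _] etc. refer to finset.     *)
From mathcomp Require Import boolp classical_sets reals ereal.

Section Steklov.
Context {R : realType} {V : finType}.
Local Open Scope ring_scope.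

(* The sum ranges over ordered pairs, so each undirected edge occurs twice.     *)
Definition dirichlet_energy (e : rel V) (f : {ffun V -> R^o}) : R :=
  2^-1 * \sum_(p : V * V | e p.1 p.2) (f p.1 - f p.2) ^+ 2.

Definition rayleigh (e : rel V) (dO : {set V}) (f : {ffun V -> R^o}) : \bar R :=
  if [forall x in dO, f x == 0] then +oo%E
  else (dirichlet_energy e f / \sum_(x in dO) (f x) ^+ 2)%:E.

(* The min-max of the Rayleigh quotient, with min and max taken as infimum and  *)
(* supremum in the extended reals so that the definition is total.              *)
Definition steklov (e : rel V) (dO : {set V}) (k : nat) : \bar R :=
  ereal_inf
    [set ereal_sup
       [set rayleigh e dO f | f in [set f | f != 0 /\ f \in W]]
    | W in [set W : {vspace {ffun V -> R^o}} | \dim W = k]]%classic.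

End Steklov.

(* Main.v *)
Require Import Defs.
From HB Require Import structures.
From mathcomp Require Import all_boot all_order all_algebra.
From mathcomp Require Import reals ereal.
From mathcomp Require Import zify ring lra.

(* For an edge wu, let K be the block containing it and let A be the set of     *)
(* vertices reachable from w without using an edge of K. The functions that are *)
(* constant on A and on its complement form a test space of dimension 2, and    *)
(* only the |K| - 1 edges of K at w are cut. Such a space gives the bound as    *)
(* soon as A and its complement both carry at least |dO|/(2(D-1)) boundary      *)
(* points. Otherwise each branch A is either light or heavy: counting over the  *)
(* at most D vertices of a block, every block has a heavy branch, and counting  *)
(* over the at most D edges at a vertex, every vertex has a light one. From a   *)
(* smallest heavy branch at w, stepping through a block with a light branch at  *)
(* w to the heavy branch of that block gives a smaller heavy branch.            *)

Set Implicit Arguments.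
Unset Strict Implicit.
Unset Printing Implicit Defensive.

Import Order.TTheory GRing.Theory Num.Theory.

(** The structural fact behind the argument is [cycle_clique]: a cycle of a block graph lies in one
    block, so its vertices are pairwise adjacent. Hence the block of an edge is the intersection of
    two closed neighbourhoods, and a branch meets its block only at its root ([branch_meet_block]),
    which is why so few edges are cut. [exists_balanced_branch] is a centroid argument on the
    resulting tree of blocks. For the branch it yields, [energy_two_valued_branch] and [steklov2_le]
    reduce the theorem to [balanced_cut_bound], an inequality between two reals a and b: one side of
    the cut carries at least half of the boundary, the other at least a share 1/(2(D-1)), and
    together these give the factor 4(D-1). *)

Lemma card_bigcup_le (I T : finType) (P : pred I) (F : I -> {set T}) :
  #|\bigcup_(i | P i) F i| <= \sum_(i | P i) #|F i|.
Proof.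
elim/big_rec2: _ => [|i n A _ le_An]; first by rewrite cards0.
by rewrite (leq_trans (leq_card_setU _ _)) ?leq_add2l.
Qed.

Lemma connect_ind (T : finType) (e : rel T) (x : T) (P : T -> Prop) :
  P x -> (forall y z, connect e x y -> P y -> e y z -> P z) ->
  forall y, connect e x y -> P y.
Proof.
move=> Px stepP y /connectP [p + ->] {y}.
elim/last_ind: p => [|p y IHp] //=.
rewrite rcons_path last_rcons => /andP[ep ey].
by apply: stepP ey; [apply/connectP; exists p | apply: IHp].
Qed.

(** * Cliques, cycles and blocks of a block graph *)

Section Graph.
Context {V : finType} (e : rel V) (e_sym : symmetric e) (e_irr : irreflexive e).

Lemma adj_graph_of : adj (graph_of e) =2 e.
Proof.
move=> x y; apply/imsetP/idP => [[[a b]]|exy]; last by exists (x, y); rewrite ?inE.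
rewrite inE /= => eab eq_xy.
have /set2P[xE|xE] : x \in [set a; b] by rewrite -eq_xy set21.
all: have /set2P[yE|yE] : y \in [set a; b] by rewrite -eq_xy set22.
all: have /set2P[aE|aE] : a \in [set x; y] by rewrite eq_xy set21.
all: have /set2P[bE|bE] : b \in [set x; y] by rewrite eq_xy set22.
all: by subst; rewrite ?(e_irr _) // in eab *; rewrite e_sym.
Qed.

Definition induced (S : {set V}) : graph_in V :=
  (S, [set E in (graph_of e).2 | E \subset S]).

Lemma adj_induced S x y :
  adj (induced S) x y = [&& e x y, x \in S & y \in S].
Proof. by rewrite {1}/adj /= in_set subUset !sub1set -adj_graph_of. Qed.

Lemma adj_delete_induced S v x y :
  adj (delete_vertex (induced S) v) x y =
  [&& e x y, x \in S :\ v & y \in S :\ v].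
Proof.
have -> : adj (delete_vertex (induced S) v) x y =
    adj (induced S) x y && (v \notin [set x; y]) by rewrite /adj /= [LHS]in_set.
rewrite adj_induced !inE !(eq_sym v).
by case: (e x y); case: (x == v); case: (y == v); case: (x \in S); case: (y \in S).
Qed.

Context (e_block : block_graph e).

Lemma block_graph_connect x y : connect e x y.
Proof.
case/andP: e_block => /andP[_ /forall_inP H] _.
have /forall_inP /(_ y) := H x (in_setT _).
by rewrite (eq_connect adj_graph_of) => ->.
Qed.

Definition adj_or_eq (x y : V) : bool := (x == y) || e x y.

(* S spans a nonseparable subgraph; a largest one above it is a block, so complete. *)
Lemma nonseparable_clique (S : {set V}) :
  S != set0 ->
  (forall x y, x \in S -> y \in S ->
     connect [rel a b | [&& e a b, a \in S & b \in S]] x y) ->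
  (forall v x y, x \in S :\ v -> y \in S :\ v ->
     connect [rel a b | [&& e a b, a \in S :\ v & b \in S :\ v]] x y) ->
  #|S| <= max_block_size e /\ {in S &, forall x y, adj_or_eq x y}.
Proof.
move=> S_nz S_conn S_del.
pose nonsep (K : graph_in V) := [&& subgraph K (graph_of e), connected_graph K
      & [forall v, ~~ cut_vertex K v]].
have nsS : nonsep (induced S) && (S \subset (induced S).1).
  rewrite subxx andbT; apply/and3P; split.
  - apply/and3P; split; first exact: subsetT.
      by apply/subsetP => E; rewrite inE => /andP[].
    by apply/forall_inP => E; rewrite inE => /andP[].
  - rewrite /connected_graph S_nz /=.
    apply/forall_inP => x Sx; apply/forall_inP => y Sy.
    by rewrite (eq_connect (adj_induced S)) S_conn.
  - apply/forallP => v; apply/negP => /andP[_ /exists_inP[x Sx /exists_inP[y Sy]]].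
    by rewrite (eq_connect (adj_delete_induced S v)) S_del ?andbF.
(* Maximality in [is_block] concerns vertices and edges at once, so the sum of the two cardinals is
   maximised. *)
pose P (H : graph_in V) := nonsep H && (S \subset H.1).
have [H /andP[nsH sSH] maxH] :=
  @arg_maxnP _ (induced S) P (fun H => #|H.1| + #|H.2|) nsS.
have blkH : is_block e H.
  rewrite /is_block -/(nonsep H) nsH /=; apply/forallP => K; apply/implyP.
  rewrite -/(nonsep K) => /andP[nsK /and3P[sHK1 sHK2 _]].
  have := maxH K; rewrite /P nsK (subset_trans sSH sHK1) => /(_ isT) /= le_KH.
  have leH1 := subset_leq_card sHK1; have leH2 := subset_leq_card sHK2.
  have eH1 : H.1 == K.1.
    by rewrite eqEcard sHK1; rewrite -(leq_add2r #|H.2|) (leq_trans _ le_KH) ?leq_add2l.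
  have eH2 : H.2 == K.2.
    by rewrite eqEcard sHK2; rewrite -(leq_add2l #|H.1|) (leq_trans _ le_KH) ?leq_add2r.
  by rewrite eq_sym -pair_eqE /= eH1 eH2.
split.
  apply: leq_trans (subset_leq_card sSH) _.
  exact: (@leq_bigmax_cond _ (is_block e) (fun H : graph_in V => #|H.1|) _ blkH).
move=> x y Sx Sy; rewrite /adj_or_eq; case: eqVneq => //= neq_xy.
case/andP: e_block => _ /forallP /(_ H); rewrite blkH /=.
move=> /forall_inP /(_ x (subsetP sSH x Sx)).
move=> /forall_inP /(_ y (subsetP sSH y Sy)); rewrite neq_xy /= => Hxy.
by rewrite -adj_graph_of; case/and3P: nsH => /and3P[_ /subsetP sHe _] _ _; apply: sHe.
Qed.

Lemma adj_or_eqC x y : adj_or_eq x y = adj_or_eq y x.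
Proof. by rewrite /adj_or_eq eq_sym e_sym. Qed.

Lemma adj_or_eq_refl x : adj_or_eq x x.
Proof. by rewrite /adj_or_eq eqxx. Qed.

Lemma adj_or_eq_edge x y : x != y -> adj_or_eq x y -> e x y.
Proof. by rewrite /adj_or_eq => /negbTE ->. Qed.

Lemma clique_card_le (S : {set V}) :
  {in S &, forall x y, adj_or_eq x y} -> #|S| <= max_block_size e.
Proof.
case: (set_0Vmem S) => [->|[x0 Sx0] clS]; first by rewrite cards0.
have conn (T : {set V}) x y : T \subset S -> x \in T -> y \in T ->
    connect [rel a b | [&& e a b, a \in T & b \in T]] x y.
  move=> /subsetP TS Tx Ty; case: (eqVneq x y) => [->|neq_xy]; first exact: connect0.
  by apply: connect1; rewrite /= Tx Ty (adj_or_eq_edge neq_xy) // clS ?TS.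
apply: (proj1 (nonseparable_clique _ _ _)).
- by apply/set0Pn; exists x0.
- by move=> x y; apply: conn.
- by move=> v x y; apply: conn; apply: subD1set.
Qed.

Lemma path_connect_induced (S : {set V}) x p :
  path e x p -> {subset x :: p <= S} -> {in x :: p &, forall y z,
    connect [rel a b | [&& e a b, a \in S & b \in S]] y z}.
Proof.
move=> ep pS.
have ep' : path [rel a b | [&& e a b, a \in S & b \in S]] x p.
  elim: p x ep pS => //= y p IHp x /andP[-> ep] pS.
  rewrite !pS ?inE ?eqxx ?orbT //=; apply: IHp => // z pz.
  by rewrite pS // inE pz orbT.
have sym : connect_sym [rel a b | [&& e a b, a \in S & b \in S]].
  by apply: sym_connect_sym; move=> a b; rewrite /= e_sym [X in _ && X]andbC.
move=> y z py pz; apply: (@connect_trans _ _ x); last exact: (path_connect ep').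
by rewrite sym; apply: (path_connect ep').
Qed.

(** A cycle is nonseparable: rotated so that a deleted vertex comes first, what remains is a
    path. *)
Lemma cycle_clique c : ucycle e c -> {in c &, forall x y, adj_or_eq x y}.
Proof.
case: (posnP (size c)) => [/size0nil -> //|c_gt0 /andP[ec uc]].
case: c => // x0 c in ec uc c_gt0 *.
move=> x y cx cy.
apply: (proj2 (@nonseparable_clique [set x in x0 :: c] _ _ _)); rewrite ?in_set //.
- by apply/set0Pn; exists x0; rewrite !inE eqxx.
- move=> {x y cx cy}x y; rewrite 2!in_set; apply: path_connect_induced.
    by move: ec; rewrite /= rcons_path => /andP[].
  by move=> z; rewrite in_set.
- move=> v {x y cx cy}x y; case: (boolP (v \in x0 :: c)) => [|cv].
    move=> /rot_to [i p rotp].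
    have memp z : (z \in x0 :: c) = (z \in v :: p) by rewrite -rotp mem_rot.
    have : path e v p.
      move: ec; rewrite -(rot_cycle i) rotp /= rcons_path; by case/andP.
    have : uniq (v :: p) by rewrite -rotp rot_uniq.
    rewrite /= => /andP[vp _] ep.
    have sub z : z \in [set x in x0 :: c] :\ v -> z \in p.
      by rewrite in_setD1 in_set memp inE; case: eqP.
    move=> /sub px /sub py.
    case: p rotp memp ep vp sub px py => // a p rotp memp /= /andP[_ ep] vp _.
    apply: path_connect_induced => // z pz.
    rewrite in_setD1 in_set memp inE pz orbT andbT.
    by apply: contraNneq vp => <-.
  rewrite !in_setD1 2!in_set => /andP[_ cx] /andP[_ cy].
  apply: (path_connect_induced (x := x0) (p := c)) => //.
    by move: ec; rewrite /= rcons_path => /andP[].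
  by move=> z cz; rewrite in_setD1 in_set cz andbT; apply: contraNneq cv => <-.
Qed.


(* In a block graph, the only block containing the edge xy.                     *)
Definition edge_block x y : {set V} := [set z | adj_or_eq x z && adj_or_eq y z].

Lemma edge_block_self x y : e x y -> (x \in edge_block x y) /\ (y \in edge_block x y).
Proof. by move=> exy; rewrite !inE /adj_or_eq !eqxx (e_sym y x) exy !orbT. Qed.

(** Two further common neighbours z, t of x and y close the 4-cycle x z y t, to which [cycle_clique]
    applies. *)
Lemma edge_block_clique x y :
  e x y -> {in edge_block x y &, forall z t, adj_or_eq z t}.
Proof.
move=> exy z t; rewrite !inE => /andP[xz yz] /andP[xt yt].
case: (eqVneq z t) => [->|zt]; first exact: adj_or_eq_refl.
case: (eqVneq x z) xz => [<- //|neq_xz xz].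
case: (eqVneq y z) yz => [<- //|neq_yz yz].
case: (eqVneq x t) xt => [<- _|neq_xt xt]; first by rewrite adj_or_eqC.
case: (eqVneq y t) yt => [<- _|neq_yt yt]; first by rewrite adj_or_eqC.
have neq_xy : x != y by apply: contraTneq exy => ->; rewrite e_irr.
apply: (@cycle_clique [:: x; z; y; t]); rewrite ?inE ?eqxx ?orbT //.
rewrite /ucycle /= !inE !negb_or neq_xz neq_xy neq_xt (eq_sym z) neq_yz zt neq_yt.
by rewrite (adj_or_eq_edge neq_xz) // (e_sym z) !adj_or_eq_edge //  1?eq_sym // adj_or_eqC.
Qed.

(** A clique containing u and v lies in [edge_block u v]. This gives one inclusion; it puts x and y
    into the clique [edge_block u v], which gives the other. *)
Lemma edge_block_unique x y u v : e x y ->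
  u \in edge_block x y -> v \in edge_block x y -> e u v ->
  edge_block u v = edge_block x y.
Proof.
move=> exy Ku Kv euv; have clK := edge_block_clique exy.
have [Kx Ky] := edge_block_self exy.
have sub_uv z : z \in edge_block x y -> z \in edge_block u v.
  by move=> Kz; rewrite inE !clK.
apply/setP => z; apply/idP/idP; last exact: sub_uv.
by move=> Kz; rewrite inE !(edge_block_clique euv) // sub_uv.
Qed.

(** * Branches hanging off a block *)

Definition off_block (K : {set V}) : rel V :=
  [rel a b | e a b && ~~ ((a \in K) && (b \in K))].

Definition branch (K : {set V}) (v : V) : {set V} :=
  [set z | connect (off_block K) v z].

Lemma branch_self K v : v \in branch K v.
Proof. by rewrite inE connect0. Qed.

Lemma branch_edge K v a b : e a b -> a \in branch K v ->
  b \notin branch K v -> (a \in K) && (b \in K).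
Proof.
rewrite !inE => eab va; apply: contraR => nKab.
by apply: connect_trans va (connect1 _); rewrite /off_block /= eab.
Qed.

(** A simple path off K from v to another vertex u of K closes, by the edge uv, to a cycle. Its
    second vertex is then adjacent or equal to both u and v, hence lies in K, so the first edge of
    the path was an edge of K. *)
Lemma branch_meet_block x y v u : e x y ->
  v \in edge_block x y -> u \in edge_block x y ->
  u \in branch (edge_block x y) v -> u = v.
Proof.
move=> exy Kv Ku; rewrite inE => /connectP[p0 /shortenP[p pv up _] uE] {p0}.
apply/eqP; apply: contraT => neq_uv; have clK := edge_block_clique exy.
have euv : e u v by apply: adj_or_eq_edge => //; apply: clK.
have cyc : ucycle e (v :: p).
  rewrite /ucycle up andbT /= rcons_path -uE euv andbT.
  by apply: sub_path pv => a b /andP[].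
case: p uE pv cyc {up} => [/= uE|a p uE /= /andP[/andP[eva nKva] _] cyc].
  by rewrite uE eqxx in neq_uv.
have clc := cycle_clique cyc.
have uc : u \in [:: v, a & p] by rewrite uE mem_last.
suff Ka : a \in edge_block x y by rewrite Kv Ka in nKva.
rewrite -(edge_block_unique exy Ku Kv euv) inE.
by rewrite !clc // !inE eqxx ?orbT.
Qed.

Lemma branch_cover x y : e x y ->
  \bigcup_(v in edge_block x y) branch (edge_block x y) v = setT.
Proof.
move=> exy; apply/setP => z; rewrite in_setT; apply/bigcupP.
have [Kx _] := edge_block_self exy.
elim/connect_ind: (block_graph_connect x z) => [|a b _ [v Kv va] eab].
  by exists x; rewrite ?branch_self.
case: (boolP (b \in branch (edge_block x y) v)) => [vb|]; first by exists v.
by move=> /(branch_edge eab va) /andP[_ Kb]; exists b; rewrite ?branch_self.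
Qed.

(** The first step of a walk from w to some b leaves the branch at w for the block of wb. The walk
    can re-enter that branch only at a vertex of the block, that is, at w itself. *)
Lemma branchC_cover w :
  w |: \bigcup_(u in [set u | e w u]) ~: branch (edge_block w u) w = setT.
Proof.
suff H z : z = w \/ exists2 u, e w u & z \notin branch (edge_block w u) w.
  apply/setP => z; rewrite in_setT in_setU1; case: (H z) => [->|[u ewu zw]].
    by rewrite eqxx.
  by apply/orP; right; apply/bigcupP; exists u; [rewrite in_set | rewrite in_setC].
have out u t : e w u -> t \in edge_block w u -> t != w ->
    t \notin branch (edge_block w u) w.
  move=> ewu Kt; apply: contra => /(branch_meet_block ewu _ Kt) ->//.
  by case: (edge_block_self ewu).
elim/connect_ind: (block_graph_connect w z) => [|a b _ IHa eab]; first by left.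
case: (eqVneq b w) => [|neq_bw]; [by left | right].
case: IHa => [eq_aw|[u ewu aw]].
  rewrite eq_aw in eab; exists b => //.
  by apply: out => //; case: (edge_block_self eab).
exists u => //; apply/negP => wb.
rewrite e_sym in eab; have /andP[Kb _] := branch_edge eab wb aw.
by move/negP: (out _ _ ewu Kb neq_bw).
Qed.

(** The edge wt is not in the first block, so t lies in the larger branch. A walk from t off the
    second block avoids w, and w is the only vertex through which it could leave that branch. *)
Lemma branch_proper x y u v w : e x y -> e u v ->
  edge_block x y != edge_block u v ->
  w \in edge_block x y -> w \in edge_block u v ->
  forall t, t \in edge_block u v -> t != w ->
  branch (edge_block u v) t \proper branch (edge_block x y) w.
Proof.
move=> exy euv neqK Kw Lw t Lt neq_tw.
have nwt : w \notin branch (edge_block u v) t.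
  by apply: contra neq_tw => /(branch_meet_block euv Lt Lw) ->.
have ewt : e w t.
  by apply: adj_or_eq_edge (edge_block_clique euv Lw Lt); rewrite eq_sym.
apply/properP; split; last by exists w => //; rewrite branch_self.
apply/subsetP => z; rewrite inE.
elim/connect_ind => [|a b ta aw eab].
  apply: contraT => ntw; have /andP[_ Kt] := branch_edge ewt (branch_self _ w) ntw.
  by rewrite -(edge_block_unique exy Kw Kt ewt) (edge_block_unique euv Lw Lt ewt) eqxx in neqK.
apply: contraT => nbw; case/andP: eab => eab' _.
have /andP[Ka _] := branch_edge eab' aw nbw.
have aE := branch_meet_block exy Kw Ka aw.
by move: nwt; rewrite inE -aE ta.
Qed.


(** * Counting boundary points: a balanced branch exists *)

Lemma degree_le_max x : degree e x <= max_degree e.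
Proof. exact: (@leq_bigmax _ (degree e)). Qed.

Lemma clique_subset_nbhd (S : {set V}) x :
  {in S &, forall z t, adj_or_eq z t} -> x \in S -> S \subset x |: [set y | e x y].
Proof.
by move=> clS Sx; apply/subsetP => y Sy; rewrite !inE eq_sym; apply: clS.
Qed.

Section Centroid.
Context (dO : {set V}) (hD : 2 <= max_degree e) (hdO : 2 <= #|dO|)
  (dO_leaf : dO \subset leaf_set e).

Local Notation n := #|dO|.
Local Notation D := (max_degree e).
Local Notation mass K v := #|dO :&: branch K v|.

(** The bound D + 1 for cliques would not do in [exists_heavy_branch], where 2(D-1) must be at least
    the size of the block: it fails for D = 2. *)
Lemma card_edge_block_le x y : e x y -> #|edge_block x y| <= D.
Proof.
move=> exy; have clK := edge_block_clique exy; have [Kx _] := edge_block_self exy.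
have nbhd_card z : #|z |: [set y | e z y]| = (degree e z).+1.
  by rewrite cardsU1 inE e_irr.
have card_le z : z \in edge_block x y -> #|edge_block x y| <= (degree e z).+1.
  by move=> Kz; rewrite -nbhd_card subset_leq_card ?clique_subset_nbhd.
rewrite leqNgt; apply/negP => gtD.
(* A block with more than D vertices would be the whole graph, without leaves. *)
have allK z : z \in edge_block x y.
  elim/connect_ind: (block_graph_connect x z) => // a b _ Ka eab.
  suff /eqP -> : edge_block x y == a |: [set y | e a y] by rewrite !inE eab orbT.
  rewrite eqEcard clique_subset_nbhd // nbhd_card.
  exact: leq_ltn_trans (degree_le_max a) gtD.
have /card_gt0P[l dOl] : 0 < n by apply: ltnW.
have := subsetP dO_leaf l dOl; rewrite inE => /eqP l1.
have := leq_trans gtD (card_le l (allK l)); rewrite l1 => D1.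
by have := leq_trans hD D1.
Qed.

Lemma exists_heavy_branch x y : e x y ->
  exists2 v, v \in edge_block x y &
    n <= 2 * D.-1 * mass (edge_block x y) v.
Proof.
move=> exy; set K := edge_block x y.
apply/exists_inP; apply: contraT; rewrite negb_exists_in => /forall_inP small.
have le_sum : n <= \sum_(v in K) mass K v.
  rewrite -[in n](setIT dO) -(branch_cover exy) big_distrr.
  exact: card_bigcup_le.
have : 2 * D.-1 * n <= #|K| * n.-1.
  apply: leq_trans (leq_mul (leqnn _) le_sum) _.
  rewrite big_distrr -sum_nat_const leq_sum // => v Kv.
  have := small v Kv; rewrite -ltnNge /=; lia.
have := card_edge_block_le exy; rewrite -/K; nia.
Qed.

Lemma exists_light_branch w u0 : e w u0 ->
  exists2 u, e w u &
    n <= 2 * D.-1 * (n - mass (edge_block w u) w).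
Proof.
move=> ewu0; apply/exists_inP; apply: contraT.
rewrite negb_exists_in => /forall_inP small.
have massC K : n - mass K w = #|dO :&: ~: branch K w|.
  by rewrite -setDE -cardsDS ?subsetIl // setDIr setDv set0U.
have le_sum : n <= (w \in dO) + \sum_(u in [set u | e w u]) (n - mass (edge_block w u) w).
  rewrite -[in leqLHS](setIT dO) -(branchC_cover w) setIUr.
  apply: leq_trans (leq_card_setU _ _) (leq_add _ _).
    case: (boolP (w \in dO)) => wdO.
      by rewrite (leq_trans (subset_leq_card (subsetIr _ _))) ?cards1.
    by rewrite leqn0 cards_eq0 setI_eq0 disjoint_sym disjoints1.
  rewrite big_distrr; apply: leq_trans (card_bigcup_le _ _) _.
  by rewrite leq_sum // => u _; rewrite massC.
have : 2 * D.-1 * (n - (w \in dO)) <= degree e w * n.-1.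
  apply: (@leq_trans (2 * D.-1 * \sum_(u in [set u | e w u]) (n - mass (edge_block w u) w))).
    by rewrite leq_mul2l leq_subLR le_sum orbT.
  rewrite big_distrr -sum_nat_const leq_sum // => u; rewrite inE => ewu.
  have := small u ewu; rewrite -ltnNge /=; lia.
(* The cover misses w. If w is a boundary point this costs one unit, but then w is a leaf and only
   one branch is summed. *)
case: (boolP (w \in dO)) => [wdO|_].
  have := subsetP dO_leaf w wdO; rewrite inE => /eqP ->; nia.
have := degree_le_max w; nia.
Qed.

Lemma exists_balanced_branch :
  exists w u, [/\ e w u, n <= 2 * D.-1 * mass (edge_block w u) w
    & n <= 2 * D.-1 * (n - mass (edge_block w u) w)].
Proof.
pose heavy (p : V * V) := e p.1 p.2 && (n <= 2 * D.-1 * mass (edge_block p.1 p.2) p.1).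
(* A branch is encoded by its root and an edge of the block at that root; the heavy root v need not
   be an end of xy. *)
have reroot x y v : e x y -> v \in edge_block x y ->
    exists2 u, e v u & edge_block v u = edge_block x y.
  move=> exy Kv; have [Kx Ky] := edge_block_self exy.
  have neq_xy : x != y by apply: contraTneq exy => ->; rewrite e_irr.
  have [u Ku neq_vu] : exists2 u, u \in edge_block x y & v != u.
    by case: (eqVneq v x) => [->|?]; [exists y | exists x].
  have evu : e v u by apply: adj_or_eq_edge (edge_block_clique exy Kv Ku).
  by exists u => //; apply: edge_block_unique.
have [x [y exy]] : exists x y, e x y.
  case: (boolP [exists x, [exists y, e x y]]) => [/existsP[x /existsP[y exy]]|].
    by exists x, y.
  rewrite negb_exists => /forallP noe; move: hD; rewrite leqNgt => /negP[].
  rewrite ltnS; apply/bigmax_leqP => x _.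
  rewrite (leq_trans _ (leq0n 1)) // leqn0 cards_eq0; apply/eqP/setP => y.
  by rewrite !inE; move: (noe x); rewrite negb_exists => /forallP/(_ y)/negbTE.
have [v Kv hv] := exists_heavy_branch exy.
have [u evu KE] := reroot _ _ _ exy Kv.
have heavy_vu : heavy (v, u) by rewrite /heavy /= evu KE.
have [[w t] /andP[/= ewt hw] min_w] :=
  @arg_minnP _ (v, u) heavy (fun p => #|branch (edge_block p.1 p.2) p.1|) heavy_vu.
have [s ews light_s] := exists_light_branch ewt.
case: (boolP (heavy (w, s))) => [/andP[/= _ hs]|]; first by exists w, s.
rewrite /heavy /= ews /= => light_ws.
have [r Kr hr] := exists_heavy_branch ews.
have neq_rw : r != w by apply: contraNneq light_ws => rw; rewrite rw in hr.
have [Kw _] := edge_block_self ews; have [Kw' _] := edge_block_self ewt.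
have erw : e r w by apply: adj_or_eq_edge (edge_block_clique ews Kr Kw).
have KE' := edge_block_unique ews Kr Kw erw.
have := min_w (r, w); rewrite /heavy /= erw KE' hr => /(_ isT).
rewrite leqNgt proper_card //; apply: branch_proper => //.
(* The two blocks at w differ, since one has a heavy branch at w and the other does not. *)
by apply: contraNneq light_ws => <-.
Qed.

End Centroid.
End Graph.

(** * Test functions of a cut and the Rayleigh quotient *)

Local Open Scope ring_scope.

Section Cut.
Context {R : realType} {V : finType} (e : rel V) (e_sym : symmetric e)
  (e_irr : irreflexive e) (e_block : block_graph e).

Definition two_valued (A : {set V}) (a b : R) : {ffun V -> R^o} :=
  [ffun x => if x \in A then a else b].

Lemma energy_two_valued_branch w u a b : e w u ->
  dirichlet_energy e (two_valued (branch e (edge_block e w u) w) a b)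
    <= (#|edge_block e w u|%:R - 1) * (a - b) ^+ 2.
Proof.
move=> ewu; set K := edge_block e w u; set A := branch e K w.
have [Kw _] : w \in K /\ _ := edge_block_self e_sym ewu.
set f := two_valued A a b.
(* Both orientations of each cut edge; the factor 1/2 in the energy compensates. *)
pose E := setX [set w] (K :\ w) :|: setX (K :\ w) [set w].
have cutE p : e p.1 p.2 -> p \notin E -> (f p.1 - f p.2) ^+ 2 = 0.
  have meetA x y : e x y -> x \in A -> y \notin A -> (x == w) && (y \in K :\ w).
    move=> exy Ax nAy; have /andP[Kx Ky] := branch_edge exy Ax nAy.
    have -> := branch_meet_block e_sym e_irr e_block ewu Kw Kx Ax.
    by rewrite eqxx in_setD1 Ky andbT; apply: contraNneq nAy => ->; apply: branch_self.
  case: p => x y /= exy; rewrite in_setU !in_setX !in_set1 negb_or /= => /andP[n1 n2].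
  rewrite !ffunE; case: ifP => [Ax|/negbT nAx]; case: ifP => [Ay|/negbT nAy].
  - by rewrite subrr expr0n.
  - by rewrite (meetA x y) in n1.
  - by rewrite e_sym in exy; rewrite andbC (meetA y x) in n2.
  - by rewrite subrr expr0n.
have le_sqr p : (f p.1 - f p.2) ^+ 2 <= (a - b) ^+ 2.
  rewrite !ffunE; case: ifP => _; case: ifP => _; rewrite ?subrr ?expr0n ?sqr_ge0 //.
  by rewrite -sqrrN opprB.
have card_E : (#|E| <= 2 * #|K|.-1)%N.
  rewrite (leq_trans (leq_card_setU _ _)) // !cardsX cards1 mul1n muln1.
  by rewrite (cardsD1 w K) Kw mul2n addnn.
have K_gt0 : (0 < #|K|)%N by apply/card_gt0P; exists w.
have -> : #|K|%:R - 1 = #|K|.-1%:R :> R by rewrite -[in LHS](prednK K_gt0) -natr1 addrK.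
rewrite /dirichlet_energy ler_pdivrMl //.
apply: (@le_trans _ _ (\sum_(p in E) (a - b) ^+ 2)); last first.
  rewrite sumr_const -[leLHS]mulr_natl [leRHS]mulrA -natrM ler_wpM2r ?sqr_ge0 // ler_nat.
  exact: card_E.
rewrite (bigID (mem E)) /= [X in _ + X]big1 ?addr0 => [|p /andP[ep pE]]; last exact: cutE.
rewrite big_mkcond [leRHS]big_mkcond /=; apply: ler_sum => p _.
by case: (e _ _); case: (p \in E); rewrite /= ?le_sqr ?sqr_ge0.
Qed.

Lemma sum_two_valued (dO A : {set V}) (a b : R) :
  \sum_(x in dO) (two_valued A a b x) ^+ 2
    = a ^+ 2 * #|dO :&: A|%:R + b ^+ 2 * #|dO :\: A|%:R.
Proof.
rewrite (big_setID A) /=; congr (_ + _).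
  rewrite mulr_natr -sumr_const; apply: eq_bigr => x; rewrite in_setI => /andP[_ Ax].
  by rewrite ffunE Ax.
rewrite mulr_natr -sumr_const; apply: eq_bigr => x; rewrite in_setD => /andP[/negbTE Ax _].
by rewrite ffunE Ax.
Qed.

(* The test space consists of the functions constant on A and off A.            *)
Lemma steklov2_le (dO A : {set V}) (c : R) :
  (0 < #|dO :&: A|)%N -> (0 < #|dO :\: A|)%N ->
  (forall a b, dirichlet_energy e (two_valued A a b)
     <= c * \sum_(x in dO) (two_valued A a b x) ^+ 2) ->
  (@steklov R V e dO 2 <= c%:E)%E.
Proof.
move=> p_gt0 q_gt0 le_c.
(* A boundary point on each side makes the indicators independent and excludes the value [+oo] of
   the quotient. *)
have /card_gt0P[x] := p_gt0; rewrite in_setI => /andP[dOx Ax].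
have /card_gt0P[y] := q_gt0; rewrite in_setD => /andP[/negbTE nAy dOy].
pose W := <<[:: two_valued A 1 0; two_valued A 0 1]>>%VS.
have dimW : \dim W = 2%N.
  apply/eqP; rewrite -[2%N]/(size [:: two_valued A 1 0; two_valued A 0 1]).
  rewrite -/(free _) free_cons span_seq1 seq1_free; apply/andP; split.
    apply/negP => /vlineP[k] /ffunP /(_ x).
    by rewrite !ffunE Ax scaler0 => /eqP; rewrite oner_eq0.
  by apply/eqP => /ffunP /(_ y); rewrite !ffunE nAy => /eqP; rewrite oner_eq0.
apply: ge_ereal_inf; eexists; first by exists W.
apply: ge_ereal_sup => _ [f [f_neq0 Wf] <-].
have [a [b fE]] : exists a b, f = two_valued A a b.
  move: Wf; rewrite /W span_cons span_seq1.
  move=> /memv_addP[_ /vlineP[a ->] [_ /vlineP[b ->] ->]]; exists a, b.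
  apply/ffunP => z; rewrite !ffunE; case: ifP => _.
    by rewrite scaler0 addr0 [LHS]mulr1.
  by rewrite scaler0 add0r [LHS]mulr1.
have ab_neq0 : (a != 0) || (b != 0).
  rewrite -negb_and; apply: contra f_neq0 => /andP[/eqP a0 /eqP b0].
  by apply/eqP/ffunP => z; rewrite fE a0 b0 !ffunE if_same.
rewrite /rayleigh ifF; last first.
  apply/negbTE; move: ab_neq0; rewrite -negb_and; apply: contra => /forall_inP f0.
  have := f0 x dOx; have := f0 y dOy; rewrite fE !ffunE Ax nAy => -> ->; exact: isT.
rewrite lee_fin fE ler_pdivrMr ?le_c // sum_two_valued.
have sqr_pos (r : R) m : r != 0 -> (0 < m)%N -> 0 < r ^+ 2 * m%:R.
  by move=> r_neq0 m_gt0; rewrite mulr_gt0 ?ltr0n // exprn_even_gt0.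
have sqr_nneg (r : R) m : 0 <= r ^+ 2 * m%:R by rewrite mulr_ge0 ?sqr_ge0 ?ler0n.
case/orP: ab_neq0 => ?.
  by rewrite ltr_pwDl ?sqr_pos.
by rewrite ltr_wpDl ?sqr_pos.
Qed.

End Cut.

(** Applied with p, q the numbers of boundary points on the two sides, c = B - 1 and d = D - 1. A
    weighted Cauchy-Schwarz inequality is combined with (p + q)^2 <= 4 d p q, the product of the
    bounds p + q <= 2 d min(p, q) and p + q <= 2 max(p, q). *)
Lemma balanced_cut_bound (R : realFieldType) (a b p q c d : R) :
  0 < p -> 0 < q -> 0 <= c -> 0 <= d ->
  p + q <= 2 * d * p -> p + q <= 2 * d * q ->
  c * (a - b) ^+ 2 <= 4 * c * d / (p + q) * (a ^+ 2 * p + b ^+ 2 * q).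
Proof.
move=> p_gt0 q_gt0 c_ge0 d_ge0 dp dq; have n_gt0 : 0 < p + q by apply: addr_gt0.
have pq_gt0 : 0 < p * q by apply: mulr_gt0.
have -> : 4 * c * d / (p + q) * (a ^+ 2 * p + b ^+ 2 * q)
    = c * (4 * d * (a ^+ 2 * p + b ^+ 2 * q) / (p + q)) by ring.
rewrite ler_wpM2l // ler_pdivlMr // -(ler_pM2l pq_gt0).
(* The difference of the two sides is (a p + b q)^2. *)
have CS : p * q * (a - b) ^+ 2 <= (a ^+ 2 * p + b ^+ 2 * q) * (p + q).
  by rewrite -subr_ge0; apply: le_trans (sqr_ge0 (a * p + b * q)) _; lra.
have npq : (p + q) ^+ 2 <= 4 * d * (p * q).
  case: (leP p q) => pq.
    have H : (p + q) * (p + q) <= (2 * d * p) * (2 * q) by apply: ler_pM; lra.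
    by move: H; lra.
  have H : (p + q) * (p + q) <= (2 * d * q) * (2 * p) by apply: ler_pM; lra.
  by move: H; lra.
have S_ge0 : 0 <= a ^+ 2 * p + b ^+ 2 * q.
  by apply: addr_ge0; apply: mulr_ge0; rewrite ?sqr_ge0 ?ltW.
rewrite mulrA; apply: (le_trans (ler_wpM2r (ltW n_gt0) CS)).
have := ler_wpM2r S_ge0 npq; lra.
Qed.

Theorem theorem1p2 (R : realType) (V : finType) (e : rel V) (dO : {set V})
    (e_sym : symmetric e) (e_irr : irreflexive e)
    (e_block : block_graph e)
    (hD : (2 <= max_degree e)%N)
    (hdO : (2 <= #|dO|)%N)
    (dO_leaf : dO \subset leaf_set e) :
  (@steklov R V e dO 2
    <= (4 * ((max_block_size e)%:R - 1) * ((max_degree e)%:R - 1)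
        / #|dO|%:R)%:E)%E.
Proof.
have [w [u [ewu le_p]]] := exists_balanced_branch e_sym e_irr e_block hD hdO dO_leaf.
set K := edge_block e w u in le_p *; set A := branch e K w in le_p *.
have [Kw _] : w \in K /\ _ := edge_block_self e_sym ewu.
have -> : (#|dO| - #|dO :&: A| = #|dO :\: A|)%N by rewrite -(cardsID A dO) addKn.
move=> le_q.
have p_gt0 : (0 < #|dO :&: A|)%N by move: le_p; case: #|_ :&: _| => //; lia.
have q_gt0 : (0 < #|dO :\: A|)%N by move: le_q; case: #|_ :\: _| => //; lia.
apply: (steklov2_le p_gt0 q_gt0) => a b.
have leKB : (#|K| <= max_block_size e)%N.
  exact: (clique_card_le e_sym e_irr e_block (edge_block_clique e_sym e_irr e_block ewu)).
have K_gt0 : (0 < #|K|)%N by apply/card_gt0P; exists w.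
apply: le_trans (energy_two_valued_branch e_sym e_irr e_block a b ewu) _.
apply: (@le_trans _ _ (((max_block_size e)%:R - 1) * (a - b) ^+ 2)).
  by apply: ler_wpM2r; rewrite ?sqr_ge0 ?lerD2r ?ler_nat.
rewrite sum_two_valued.
have nE : #|dO|%:R = #|dO :&: A|%:R + #|dO :\: A|%:R :> R by rewrite -natrD cardsID.
have D_pred : (max_degree e)%:R - 1 = (max_degree e).-1%:R :> R.
  by rewrite -[in LHS](prednK (ltnW hD)) -natr1 addrK.
rewrite nE D_pred; apply: balanced_cut_bound; rewrite ?ltr0n ?ler0n //.
- by rewrite subr_ge0 ler1n (leq_trans K_gt0).
- by rewrite -nE -!natrM ler_nat.
- by rewrite -nE -!natrM ler_nat.
Qed.
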